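(* Let $\varphi:F_2\times X\to X$ be a continuous action of the free group $F_2=\langle a,b\rangle$ on a compact metric space $(X,d)$. If $\varphi:F_2\times X\to X$ has the persistent shadowing property, then the homeomorphism $\varphi_{a^{-1}b}:X\to X$ has the persistent shadowing property.
   Context: For an action $\varphi$ of a group $G$ on $X$ (with $\varphi(gh,x)=\varphi(g,\varphi(h,x))$, $\varphi(e,x)=x$) and $g\in G$, $\varphi_g:X\to X$ is the homeomorphism $\varphi_g(x)=\varphi(g,x)$. Let $S$ be a finite generating set of a finitely generated (discrete) group $G$. For continuous actions $\varphi,\psi$ of $G$ on $X$ put $d_S(\varphi,\psi)=\sup\{d(\varphi(s,x),\psi(s,x)): x\in X, s\in S\}$. A map $f:G\to X$ is a $\delta$-pseudo orbit for $\psi$ (with respect to $S$) if $d(f(sg),\psi(s,f(g)))<\delta$ for all $s\in S$, $g\in G$. It is $(\psi,\epsilon)$-shadowed by $p\in X$ if $d(f(g),\psi(g,p))<\epsilon$ for all $g\in G$. The action $\varphi$ has the persistent shadowing property if for every $\epsilon>0$ there is $\delta>0$ such that for every continuous action $\psi:G\times X\to X$ with $d_S(\varphi,\psi)<\delta$, every $\delta$-pseudo orbit $f:G\to X$ for $\psi$ can be $(\psi,\epsilon)$-shadowed by a point of $X$. The property does not depend on the choice of the symmetric finite generating set. A homeomorphism $h:X\to X$ has the persistent shadowing property if the $\mathbb{Z}$-action $(n,x)\mapsto h^n(x)$ does, i.e. for every $\epsilon>0$ there is $\delta>0$ such that for every homeomorphism $f:X\to X$ with $\sup_{x\in X}d(f(x),h(x))<\delta$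 and every sequence $(x_n)_{n\in\mathbb{Z}}$ with $d(f(x_n),x_{n+1})<\delta$ for all $n\in\mathbb{Z}$, there is $y\in X$ with $d(f^n(y),x_n)<\epsilon$ for all $n\in\mathbb{Z}$. *)

(* Defs.v *)
From HB Require Import structures.
From mathcomp Require Import all_boot all_order all_algebra.
From mathcomp Require Import all_classical all_reals all_analysis.
Set Implicit Arguments.
Unset Strict Implicit.
Unset Printing Implicit Defensive.

Import Order.TTheory GRing.Theory Num.Theory.

Local Open Scope group_scope.

(* The free group on T is realized by reduced words. The letter (t, b) stands
   for t if b = false and for the inverse of t if b = true. *)
Section FreeGroup.
Variable T : choiceType.

Definition letter_inv (l : T * bool) : T * bool := (l.1, ~~ l.2).

Definition reduced (w : seq (T * bool)) : bool :=
  sorted (fun l m => m != letter_inv l) w.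

Arguments reduced : simpl never.

Record free_group : Type := FreeGroup {
  fg_word : seq (T * bool);
  _ : reduced fg_word }.

HB.instance Definition _ := [isSub for fg_word].
HB.instance Definition _ := [Choice of free_group by <:].

(* left multiplication of a reduced word by one letter, with cancellation *)
Definition letter_mul (l : T * bool) (w : seq (T * bool)) : seq (T * bool) :=
  if w is m :: w' then if m == letter_inv l then w' else l :: w else [:: l].

Definition word_mul (u v : seq (T * bool)) : seq (T * bool) :=
  foldr letter_mul v u.

Definition word_inv (w : seq (T * bool)) : seq (T * bool) :=
  rev (map letter_inv w).

Lemma letter_invK : involutive letter_inv.
Proof. by case=> t b; rewrite /letter_inv /= negbK. Qed.

Lemma letter_inv_neq l : letter_inv l != l.
Proof. by case: l => t []; rewrite /letter_inv xpair_eqE andbF. Qed.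

Lemma reduced_cons l w :
  reduced (l :: w) = (if w is m :: _ then m != letter_inv l else true)
                     && reduced w.
Proof. by case: w. Qed.

Lemma letter_mul_reduced l w : reduced w -> reduced (letter_mul l w).
Proof.
case: w => [|m w] // mw; rewrite /letter_mul.
case: ifPn => [_|ml]; last by rewrite reduced_cons ml.
by move: mw; rewrite reduced_cons => /andP[].
Qed.

Lemma word_mul_reduced u v : reduced v -> reduced (word_mul u v).
Proof. by move=> rv; elim: u => //= l u; exact: letter_mul_reduced. Qed.

Lemma letter_mulK l w : reduced w ->
  letter_mul (letter_inv l) (letter_mul l w) = w.
Proof.
case: w => [|m w] /=; first by rewrite letter_invK eqxx.
move=> mw; case: eqVneq => [mE|_]; last by rewrite /= letter_invK eqxx.
case: w mw => [|k w] /=; first by rewrite mE.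
by rewrite reduced_cons mE => /andP[/negbTE -> _].
Qed.

Lemma word_mul_letter l u v : reduced v -> reduced u ->
  word_mul (letter_mul l u) v = letter_mul l (word_mul u v).
Proof.
move=> rv; case: u => [|m u] //= _; case: eqVneq => [->|] //=.
by rewrite -{1}(letter_invK l) letter_mulK ?word_mul_reduced.
Qed.

Lemma word_mulA u v w : reduced v -> reduced w ->
  word_mul u (word_mul v w) = word_mul (word_mul u v) w.
Proof.
move=> rv rw; elim: u => //= l u ->.
by rewrite word_mul_letter ?word_mul_reduced.
Qed.

Lemma word_mul_nil w : reduced w -> word_mul w [::] = w.
Proof.
elim: w => //= l w IHw; rewrite reduced_cons.
by move=> /andP[lw /IHw ->]; case: w lw {IHw} => //= m w /negbTE ->.
Qed.

Lemma word_inv_reduced w : reduced w -> reduced (word_inv w).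
Proof.
rewrite /reduced /word_inv rev_sorted sorted_map; apply: sub_sorted => l m /=.
by rewrite letter_invK eq_sym.
Qed.

Lemma word_mulV w v : reduced v -> word_mul (word_inv w) (word_mul w v) = v.
Proof.
rewrite /word_mul /word_inv -map_rev.
elim: w v => //= l w IHw v rv; rewrite rev_cons map_rcons foldr_rcons.
by rewrite letter_mulK ?IHw ?(word_mul_reduced w rv).
Qed.

Definition fg_one : free_group := @FreeGroup [::] isT.
Definition fg_inv (x : free_group) : free_group :=
  FreeGroup (word_inv_reduced (valP x)).
Definition fg_mul (x y : free_group) : free_group :=
  FreeGroup (word_mul_reduced (fg_word x) (valP y)).

Lemma fg_mulA : associative fg_mul.
Proof. by move=> x y z; apply: val_inj; rewrite /= word_mulA ?(valP _). Qed.
Lemma fg_mul1 : left_id fg_one fg_mul.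
Proof. by move=> x; apply: val_inj. Qed.
Lemma fg_mulr1 : right_id fg_one fg_mul.
Proof. by move=> x; apply: val_inj; rewrite /= word_mul_nil ?(valP _). Qed.
Lemma fg_mulV : left_inverse fg_one fg_inv fg_mul.
Proof.
move=> x; apply: val_inj => /=.
by rewrite -{2}(word_mul_nil (valP x)) word_mulV.
Qed.
Lemma fg_mulrV : right_inverse fg_one fg_inv fg_mul.
Proof.
move=> x; rewrite -[LHS]fg_mul1 -{1}(fg_mulV (fg_inv x)).
by rewrite -fg_mulA (fg_mulA (fg_inv x)) fg_mulV fg_mul1 fg_mulV.
Qed.

HB.instance Definition _ := isGroup.Build free_group
  fg_mulA fg_mul1 fg_mulr1 fg_mulV fg_mulrV.

Definition fg_gen (t : T) : free_group := @FreeGroup [:: (t, false)] isT.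

Section UniversalProperty.
Variables (G : groupType) (f : T -> G).

Definition fg_lift (x : free_group) : G :=
  \prod_(l <- fg_word x) (if l.2 then (f l.1)^-1 else f l.1).

Lemma fg_lift_gen t : fg_lift (fg_gen t) = f t.
Proof. by rewrite /fg_lift big_seq1. Qed.

Lemma fg_liftM : {morph fg_lift : x y / x * y}.
Proof.
pose ev (l : T * bool) : G := if l.2 then (f l.1)^-1 else f l.1.
have evM l w : \prod_(i <- letter_mul l w) ev i = ev l * \prod_(i <- w) ev i.
  case: w => [|m w] /=; first by rewrite big_seq1 big_nil mulg1.
  case: eqVneq => [->|_]; last by rewrite big_cons.
  rewrite big_cons mulgA /ev; case: l => t [] /=.
    by rewrite mulVg mul1g.
  by rewrite mulgV mul1g.
move=> [u ru] [v rv]; rewrite /fg_lift /= -/ev {ru rv}.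
elim: u => [|l u IHu] /=; first by rewrite big_nil mul1g.
by rewrite evM IHu [in RHS]big_cons mulgA.
Qed.

Lemma fg_lift_unique (h : free_group -> G) :
  {morph h : x y / x * y} -> (forall t, h (fg_gen t) = f t) -> h =1 fg_lift.
Proof.
move=> hM hf; have h1 : h 1 = 1.
  by apply: (mulgI (h 1)); rewrite -hM !mulg1.
have hV x : h x^-1 = (h x)^-1.
  by apply: (mulgI (h x)); rewrite -hM !mulgV.
case=> w; elim: w => [|l w IHw] rw.
  rewrite /fg_lift big_nil -h1; congr h; exact: val_inj.
have rw' : reduced w by move: (rw); rewrite reduced_cons => /andP[].
pose y : free_group := if l.2 then (fg_gen l.1)^-1 else fg_gen l.1.
have yE : FreeGroup rw = y * FreeGroup rw'.
  apply: val_inj => /=; rewrite /y.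
  have -> : fg_word (if l.2 then (fg_gen l.1)^-1 else fg_gen l.1) = [:: l].
    by case: (l) => t [].
  move: rw; rewrite reduced_cons /=; case: w rw' {IHw} => //= m w _.
  by move=> /andP[/negbTE ->].
rewrite [in LHS]yE hM IHw /fg_lift [in RHS]big_cons /y; congr (_ * _).
by case: (l.2); rewrite ?hV hf.
Qed.

End UniversalProperty.
End FreeGroup.

Definition F2 : groupType := free_group bool.
Definition F2a : F2 := fg_gen false.
Definition F2b : F2 := fg_gen true.

Definition generates (G : groupType) (S : seq G) : Prop :=
  forall H : {pred G}, group_closed H -> {subset S <= H} -> forall g, g \in H.

Local Open Scope classical_set_scope.

Record continuous_action (G : groupType) (X : topologicalType) := ContinuousAction {
  act_fun :> G -> X -> X;
  act_fun1 : forall x, act_fun 1 x = x;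
  act_funM : forall g h x, act_fun (g * h) x = act_fun g (act_fun h x);
  act_continuous :
    continuous (fun p : discrete_topology G * X => act_fun p.1 p.2) }.

Record homeo (X : topologicalType) := Homeo {
  homeo_fun :> X -> X;
  homeo_inv : X -> X;
  homeo_funK : cancel homeo_fun homeo_inv;
  homeo_invK : cancel homeo_inv homeo_fun;
  homeo_continuous : continuous homeo_fun;
  homeo_inv_continuous : continuous homeo_inv }.

Definition homeo_pow (X : topologicalType) (h : homeo X) (n : int) : X -> X :=
  match n with
  | Posz k => iter k h
  | Negz k => iter k.+1 (homeo_inv h)
  end.

Section ActionHomeo.
Variables (G : groupType) (X : topologicalType) (phi : continuous_action G X).

Lemma act_funK g : cancel (phi g) (phi g^-1).
Proof. by move=> x; rewrite -act_funM mulVg act_fun1. Qed.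

Lemma act_funVK g : cancel (phi g^-1) (phi g).
Proof. by move=> x; rewrite -act_funM mulgV act_fun1. Qed.

Lemma act_fun_continuous g : continuous (phi g).
Proof.
move=> x.
pose i (y : X) : discrete_topology G * X := (g, y).
have ci : {for x, continuous i}.
  by apply: (@cvg_pair _ _ _ _ (nbhs (g : discrete_topology G)) (nbhs x));
    [exact: cvg_cst | exact: cvg_id].
exact: (continuous_comp ci (@act_continuous _ _ phi (i x))).
Qed.

Definition act_homeo (g : G) : homeo X :=
  Homeo (act_funK g) (act_funVK g)
    (@act_fun_continuous g) (@act_fun_continuous g^-1).

End ActionHomeo.

Local Close Scope group_scope.
Local Open Scope ring_scope.

Section Shadowing.
Variables (R : realType) (X : metricType R).

Section Action.
Variables (G : groupType) (S : seq G).

(* The supremum is taken in the extended reals, so that it is meaningful also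
   without a boundedness assumption. *)
Definition act_dist (phi psi : continuous_action G X) : \bar R :=
  ereal_sup [set (mdist (phi s x) (psi s x))%:E | x in [set: X] & s in [set` S]].

Definition pseudo_orbit (psi : continuous_action G X) (delta : R)
    (f : G -> X) : Prop :=
  forall s g, s \in S -> mdist (f (s * g)%g) (psi s (f g)) < delta.

Definition shadowed (psi : continuous_action G X) (epsilon : R)
    (f : G -> X) (p : X) : Prop :=
  forall g, mdist (f g) (psi g p) < epsilon.

Definition persistent_shadowing (phi : continuous_action G X) : Prop :=
  forall epsilon : R, 0 < epsilon -> exists2 delta : R, 0 < delta &
    forall psi : continuous_action G X, (act_dist phi psi < delta%:E)%E ->
    forall f : G -> X, pseudo_orbit psi delta f ->
    exists p : X, shadowed psi epsilon f p.

End Action.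

(* This is the property of the Z-action n |-> h^n for the generating set {1}:
   a continuous Z-action is determined by the homeomorphism by which 1 acts. *)
Definition homeo_persistent_shadowing (h : homeo X) : Prop :=
  forall epsilon : R, 0 < epsilon -> exists2 delta : R, 0 < delta &
    forall f : homeo X,
    (ereal_sup [set (mdist (f x) (h x))%:E | x in [set: X]] < delta%:E)%E ->
    forall u : int -> X, (forall n : int, mdist (f (u n)) (u (n + 1)) < delta) ->
    exists y : X, forall n : int, mdist (homeo_pow f n y) (u n) < epsilon.

End Shadowing.

(* Main.v *)
Require Import Defs.
From mathcomp Require Import all_boot all_order all_algebra.
From mathcomp Require Import all_classical all_reals all_analysis.
From mathcomp Require Import lra.

(** The pair (a, a^-1 b) is again a basis of F2, and persistent shadowing is
    carried along the automorphism that maps (a, b) to it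
    ([persistent_shadowing_pullback]).  So it is enough to show that, for an
    action phi of a free group, the homeomorphism of one basis element t
    inherits persistent shadowing from phi
    ([generator_persistent_shadowing]).

    Freeness enters twice.  First, a homeomorphism f near phi_t extends to an
    action psi near phi: t acts by f, and the other basis elements act as
    before.  Second, a pseudo orbit u of f, indexed by the powers of t, extends
    to a pseudo orbit F of psi on the whole group ([extend_orbit]).  In the
    Cayley graph, a tree, F(t^n) = u(n), and away from the line of powers of t
    the value of F is propagated exactly by psi, one letter at a time.  The only
    edges with an error are therefore those between t^n and t^(n+1), where the
    error is that of u.  A point whose psi-orbit shadows F has, along the powers
    of t, an f-orbit that shadows u.

    These constructions control the errors on basis elements only, whereas the
    hypothesis measures them on an arbitrary finite set S.  By compactness all
    the maps phi_g are uniformly continuous, and the group elements along which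
    a small error at the generators causes only a small error form a subgroup,
    hence the whole group ([pseudo_orbit_reach]).  Measured against the fixed
    action phi, the orbits of a nearby action psi and the pseudo orbits of psi
    are both pseudo orbits of phi, so that this one estimate gives both the
    closeness of psi to phi on S and the pseudo orbit property of F on S. *)

Set Implicit Arguments.
Unset Strict Implicit.
Unset Printing Implicit Defensive.

Import Order.TTheory GRing.Theory Num.Theory.

Local Open Scope classical_set_scope.
Local Open Scope ring_scope.

(** * Propagation of errors from a generating set *)

(** The Heine-Cantor theorem: near each point a uniform modulus exists, and
    compactness turns these local moduli into a global one. *)
Lemma compact_uniformly_continuous (R : realType) (X Y : metricType R)
    (f : X -> Y) (e : R) :
  compact [set: X] -> continuous f -> 0 < e ->
  exists2 d : R, 0 < d & forall x y, mdist x y < d -> mdist (f x) (f y) < e.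
Proof.
move=> /compact_near_coveringP cX cf e0.
have H (x : X) : \forall x' \near x & d \near (0 : R)^'+,
    forall y, mdist x' y < d -> mdist (f x') (f y) < e.
  have : nbhs (f x) (ball (f x) (e / 2)) by apply: nbhsx_ballx; rewrite divr_gt0.
  move=> /(cf x); rewrite /= nbhs_simpl /= -nbhs_ballE => -[r /= r0 fr].
  have r20 : 0 < r / 2 by rewrite divr_gt0.
  exists (ball x (r / 2), [set d | d < r / 2]) => /=.
    by split; [exact: nbhsx_ballx | exact: nbhs_right_lt].
  move=> [x' d] /= [xx' dr] y x'y.
  rewrite ballEmdist /= in xx'.
  have := fr x'; have := fr y; rewrite !ballEmdist /= => fy fx'.
  rewrite (splitr e) (le_lt_trans (metric_triangle _ (f x) _))// ltrD//.
    by rewrite metric_sym fx'//; lra.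
  rewrite fy// (le_lt_trans (metric_triangle _ x' _))//; lra.
have {}H := cX R ((0 : R)^'+) _ _ (fun x _ => H x).
have [d [d0 dP]] := filter_ex (filterI (nbhs_right_gt 0) (H _)).
by exists d => // x y; exact: dP.
Qed.

Section Approximation.
Variables (R : realType) (X : metricType R) (G : groupType) (S : seq G).
Variable phi : continuous_action G X.

(** The set of all g that satisfy the conclusion for every eta is a subgroup
    containing S; closure under products and inverses uses that the maps phi_g are
    uniformly continuous. *)
Lemma pseudo_orbit_reach (g : G) (eta : R) :
  compact [set: X] -> generates S -> 0 < eta ->
  exists2 delta : R, 0 < delta &
    forall F, pseudo_orbit S phi delta F ->
    forall k, mdist (F (g * k)%g) (phi g (F k)) < eta.
Proof.
move=> cX genS.
pose good (g : G) := forall e : R, 0 < e -> exists2 d : R, 0 < d &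
  forall F, pseudo_orbit S phi d F ->
  forall k, mdist (F (g * k)%g) (phi g (F k)) < e.
suff gd : good g by move=> eta0; exact: gd.
suff : g \in [pred g | `[< good g >]] by rewrite inE.
apply: (genS [pred g | `[< good g >]]) => [|s sS]; last first.
  by rewrite inE => e e0; exists e => // F FP k; exact: FP.
split=> [|x y]; rewrite !inE; last move=> gx gy.
  by move=> e e0; exists 1 => // F _ k; rewrite mul1g act_fun1 mdistxx.
move=> e e0; have e20 : 0 < e / 2 by rewrite divr_gt0.
have [d1 d10 xP] := gx _ e20.
(* With m = y^-1 k, both F ((x / y) k) = F (x m) and phi_(x / y) (F k) are close
   to phi_x (F m): the former by the choice of d1, and the latter because F k is
   close to phi_y (F m), an error that phi_(x / y) must not enlarge. *)
have [c c0 cP] :=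
  compact_uniformly_continuous cX (@act_fun_continuous _ _ phi (x / y)%g) e20.
have [d2 d20 yP] := gy _ c0.
exists (Num.min d1 d2); first by rewrite lt_min d10.
move=> F FP k.
have Fd d : Num.min d1 d2 <= d -> pseudo_orbit S phi d F.
  by move=> le_d s h sS; exact: lt_le_trans (FP s h sS) le_d.
have le1 : Num.min d1 d2 <= d1 by rewrite ge_min lexx.
have le2 : Num.min d1 d2 <= d2 by rewrite ge_min lexx orbT.
have := xP F (Fd _ le1) (y^-1 * k)%g.
have := yP F (Fd _ le2) (y^-1 * k)%g.
rewrite mulVKg metric_sym mulgA => /cP.
rewrite -act_funM mulgVK => xk kx.
by rewrite (splitr e) (le_lt_trans (metric_triangle _ (phi x (F (y^-1 * k)%g)) _))// ltrD.
Qed.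

Lemma pseudo_orbit_reach_seq (s : seq G) (eta : R) :
  compact [set: X] -> generates S -> 0 < eta ->
  exists2 delta : R, 0 < delta &
    forall F, pseudo_orbit S phi delta F -> pseudo_orbit s phi eta F.
Proof.
move=> cX genS eta0; elim: s => [|g s [d1 d10 sP]].
  by exists 1.
have [d2 d20 gP] := pseudo_orbit_reach g cX genS eta0.
exists (Num.min d1 d2); first by rewrite lt_min d10.
move=> F FP h k.
have Fd d : Num.min d1 d2 <= d -> pseudo_orbit S phi d F.
  by move=> le_d x y xS; exact: lt_le_trans (FP x y xS) le_d.
rewrite inE => /predU1P[->|hs].
  by apply: gP; apply: Fd; rewrite ge_min lexx orbT.
by apply: sP => //; apply: Fd; rewrite ge_min lexx.
Qed.

End Approximation.

(** * Actions of discrete groups *)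

Section DiscreteAction.
Variables (G : groupType) (X : topologicalType) (act : G -> X -> X).
Hypotheses (act1 : forall x, act 1%g x = x)
  (actM : forall g h x, act (g * h)%g x = act g (act h x))
  (act_cont : forall g, continuous (act g)).

Lemma discrete_joint_continuous :
  continuous (fun p : discrete_topology G * X => act p.1 p.2).
Proof.
move=> [g x] U /= /(act_cont) nU.
exists ([set g], act g @^-1` U) => /=.
  by split => //; exact: (@discrete_set1 (discrete_topology G)).
by move=> [h y] /= [-> ].
Qed.

Definition discrete_action : continuous_action G X :=
  ContinuousAction act1 actM discrete_joint_continuous.

End DiscreteAction.

(** * Actions of free groups *)

Lemma free_group_cons (T : choiceType) (l : T * bool) w (rw : reduced w)
    (rlw : reduced (l :: w)) :
  FreeGroup rlw =
    ((if l.2 then (fg_gen l.1)^-1 else fg_gen l.1) * FreeGroup rw)%g.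
Proof.
apply: val_inj => /=.
have -> : fg_word (if l.2 then (fg_gen l.1)^-1 else fg_gen l.1)%g = [:: l].
  by case: (l) => t [].
move: (rlw); rewrite reduced_cons /=.
by case: w rw rlw => //= m w _ _ /andP[/negbTE ->].
Qed.

Lemma free_group_generates (T : finType) :
  generates [seq fg_gen t | t : T].
Proof.
move=> H clH subH [w]; elim: w => [|l w IHw] rw.
  by case: clH => H1 _; rewrite (_ : FreeGroup rw = 1%g)//; exact: val_inj.
have rw' : reduced w by move: (rw); rewrite reduced_cons => /andP[].
rewrite (free_group_cons rw' rw).
apply: (group_closedM clH); last exact: IHw.
have Hl : fg_gen l.1 \in H by apply: subH; exact: codom_f.
by case: l.2 => //; exact: (group_closedV clH).
Qed.

Section FreeAction.
Variables (T : choiceType) (X : topologicalType) (h : T -> homeo X).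

Definition letter_act (l : T * bool) : X -> X :=
  if l.2 then homeo_inv (h l.1) else h l.1.

Definition word_act (w : seq (T * bool)) (x : X) : X := foldr letter_act x w.

Lemma letter_act_invK (l : T * bool) :
  cancel (letter_act (letter_inv l)) (letter_act l).
Proof. by case: l => t [] x; [exact: homeo_funK|exact: homeo_invK]. Qed.

Lemma letter_act_continuous l : continuous (letter_act l).
Proof.
by case: l => t []; [exact: homeo_inv_continuous|exact: homeo_continuous].
Qed.

Lemma word_act_mul u v x :
  word_act (word_mul u v) x = word_act u (word_act v x).
Proof.
elim: u => //= l u <-; case: (word_mul u v) => //= m w.
by case: eqVneq => // ->; rewrite letter_act_invK.
Qed.

Lemma word_act_continuous w : continuous (word_act w).
Proof.
elim: w => [|l w IHw] x; first exact: cvg_id.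
exact: (continuous_comp (IHw x) (@letter_act_continuous l _)).
Qed.

(** The action that the universal property of the free group yields from an
    arbitrary choice of homeomorphisms for the basis elements. *)
Definition free_action : continuous_action (free_group T) X :=
  @discrete_action (free_group T) X (fun g => word_act (fg_word g))
    (fun=> erefl) (fun g g' => word_act_mul (fg_word g) (fg_word g'))
    (fun g => @word_act_continuous (fg_word g)).

End FreeAction.

(** * Extending a pseudo orbit from the powers of a basis element *)

Section Extension.
Variables (T : eqType) (X : Type) (act : T * bool -> X -> X) (t : T).
Variable u : int -> X.

Definition power_word (w : seq (T * bool)) : bool := all (fun l => l.1 == t) w.

Definition exponent (w : seq (T * bool)) : int :=
  \sum_(l <- w) (if l.2 then -1 else 1).

(** A word x t^n whose part x does not end in t or t^-1 is sent to x acting on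
    u n: the leading letters act one by one until a power of t is left. *)
Fixpoint extend_orbit (w : seq (T * bool)) : X :=
  if power_word w then u (exponent w) else
  if w is l :: w' then act l (extend_orbit w') else u 0.

Lemma extend_orbit_power w :
  power_word w -> extend_orbit w = u (exponent w).
Proof. by case: w => [|l w /= ->]. Qed.

Lemma exponent_cons l w :
  exponent (l :: w) = (if l.2 then -1 else 1) + exponent w.
Proof. by rewrite /exponent big_cons. Qed.

End Extension.

(** On the line of powers of t, left multiplication by t is the shift by 1,
    whether or not a cancellation occurs. *)
Lemma letter_mul_power (T : choiceType) (t : T) w : power_word t w ->
  power_word t (letter_mul (t, false) w) /\
  exponent (letter_mul (t, false) w) = exponent w + 1.
Proof.
case: w => [|m w] /=.
  by rewrite eqxx exponent_cons addrC.
move=> /andP[mt wt]; case: (eqVneq m) => [->|_] /=.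
  by rewrite wt exponent_cons /= addrAC addNr add0r.
by rewrite eqxx mt wt exponent_cons addrC.
Qed.

(** Every edge of the Cayley graph that is not on the line of powers of t is
    respected exactly.  If l cancels the first letter m of w, this is because
    the value at w was obtained by letting m act on the value at the rest. *)
Lemma extend_orbit_letter_mul (T : choiceType) (X : Type)
    (act : T * bool -> X -> X) (t : T) (u : int -> X) (l : T * bool) w :
  (forall m, cancel (act (letter_inv m)) (act m)) ->
  ~~ ((l.1 == t) && power_word t w) ->
  extend_orbit act t u (letter_mul l w) = act l (extend_orbit act t u w).
Proof.
move=> actK; case: w => [|m w] /=; first by move=> /negbTE ->.
case: (eqVneq m) => [->|ml] /=; last by move=> /negbTE ->.
by case: eqP => //= [_ /negbTE ->|_ _]; rewrite actK.
Qed.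

(** * Persistent shadowing for a basis element *)

Section Powers.
Variable T : choiceType.
Implicit Type t : T.

Definition power (t : T) (n : int) : seq (T * bool) :=
  match n with
  | Posz k => nseq k (t, false)
  | Negz k => nseq k.+1 (t, true)
  end.

Lemma power_reduced t n : reduced (power t n).
Proof.
have nsq b k : reduced (nseq k (t, b)).
  elim: k => // k IHk; rewrite [nseq _ _]/= reduced_cons IHk andbT.
  by case: k {IHk} => //= k; rewrite eq_sym letter_inv_neq.
by case: n => k; exact: nsq.
Qed.

Lemma power_power_word t n : power_word t (power t n).
Proof. by case: n => k; rewrite /power_word /power all_nseq /= eqxx ?orbT. Qed.

Lemma exponent_power t n : exponent (power t n) = n.
Proof.
case: n => k; elim: k => [|k IHk].
- by rewrite /exponent big_nil.
- by rewrite exponent_cons IHk.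
- by rewrite exponent_cons /exponent big_nil.
by rewrite [power _ _]/= exponent_cons IHk.
Qed.

Lemma homeo_pow_word_act (X : topologicalType) (h : T -> homeo X) t n x :
  homeo_pow (h t) n x = word_act h (power t n) x.
Proof.
have it b k : iter k (letter_act h (t, b)) x =
    foldr (letter_act h) x (nseq k (t, b)) by elim: k => //= k ->.
by case: n => k; [exact: (it false k)|exact: (it true k.+1)].
Qed.

End Powers.

Section GeneratorShadowing.
Variables (R : realType) (X : metricType R) (T : finType).
Variables (S : seq (free_group T)) (phi : continuous_action (free_group T) X).

(** The given f replaces phi_t, the resulting free action is psi, and F extends
    the pseudo orbit u of f to the whole group. *)
Theorem generator_persistent_shadowing (t : T) :
  compact [set: X] -> persistent_shadowing S phi ->
  homeo_persistent_shadowing (act_homeo phi (fg_gen t)).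
Proof.
move=> cX phiP eps eps0; have [d d0 {}phiP] := phiP eps eps0.
have d20 : 0 < d / 2 by rewrite divr_gt0.
have [e e0 near_phi] :=
  pseudo_orbit_reach_seq phi S cX (@free_group_generates T) d20.
(* Half of e for the pseudo orbit error of u, half for the distance from f to
   phi_t: F has to be an e-pseudo orbit of phi. *)
exists (e / 2); first by rewrite divr_gt0.
move=> f f_near u uP.
pose h s := if s == t then f else act_homeo phi (fg_gen s).
pose psi := free_action h.
have ht : h t = f by rewrite /h eqxx.
have psi_gen s x : psi (fg_gen s) x = h s x by [].
have f_dist x : mdist (f x) (phi (fg_gen t) x) < e / 2.
  rewrite -lte_fin; apply: le_lt_trans f_near; apply: ereal_sup_ubound.
  by exists x.
have h_dist s x : mdist (h s x) (phi (fg_gen s) x) < e / 2.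
  by rewrite /h; case: eqP => [->//|_]; rewrite /= mdistxx divr_gt0.
(* An orbit of psi is a pseudo orbit of phi; its error at s, read off at the
   identity of the group, is the distance from psi_s to phi_s. *)
have psi_dist s x : s \in S -> mdist (psi s x) (phi s x) < d / 2.
  move=> sS; have := near_phi (fun g => psi g x) _ s 1%g sS.
  rewrite mulg1 act_fun1; apply=> g k /codomP[r ->].
  by rewrite act_funM psi_gen (lt_trans (h_dist r _))//; lra.
pose F (g : free_group T) := extend_orbit (letter_act h) t u (fg_word g).
have F_gen s k : mdist (F (fg_gen s * k)%g) (psi (fg_gen s) (F k)) < e / 2.
  rewrite psi_gen /F /=.
  have [/andP[/eqP /= -> kt]|ns] :=
      boolP (((s, false).1 == t) && power_word t (fg_word k)).
    have [kt' kE] := letter_mul_power kt.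
    by rewrite !extend_orbit_power// kE ht metric_sym.
  rewrite extend_orbit_letter_mul// ?mdistxx ?divr_gt0//.
  exact: letter_act_invK.
have [|g k kS|p pP] := phiP psi _ F.
- apply: (@le_lt_trans _ _ (d / 2)%:E); last by rewrite lte_fin; lra.
  apply: ge_ereal_sup => _ [x _ [s sS <-]].
  by rewrite lee_fin metric_sym ltW// psi_dist.
- have Fg : mdist (F (g * k)%g) (phi g (F k)) < d / 2.
    apply: near_phi kS => s {}k /codomP[r ->].
    rewrite (splitr e).
    rewrite (le_lt_trans (metric_triangle _ (psi (fg_gen r) (F k)) _))//.
    by apply: ltrD; [exact: F_gen | exact: h_dist].
  rewrite (splitr d) (le_lt_trans (metric_triangle _ (phi g (F k)) _))//.
  by rewrite ltrD// metric_sym psi_dist.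
exists p => n.
have := pP (FreeGroup (power_reduced t n)).
rewrite /F extend_orbit_power ?power_power_word// exponent_power.
by rewrite metric_sym -ht homeo_pow_word_act.
Qed.

End GeneratorShadowing.

(** * Change of basis *)

Section Transport.
Variables (G H : groupType) (X : topologicalType).
Variable sigma : H -> G.
Hypothesis sigmaM : {morph sigma : x y / (x * y)%g}.
Variable phi : continuous_action G X.

Lemma pullback_act1 x : phi (sigma 1%g) x = x.
Proof.
rewrite (_ : sigma 1%g = 1%g) ?act_fun1//.
by apply: (mulgI (sigma 1%g)); rewrite -sigmaM !mulg1.
Qed.

Lemma pullback_actM g h x :
  phi (sigma (g * h)%g) x = phi (sigma g) (phi (sigma h) x).
Proof. by rewrite sigmaM act_funM. Qed.

Definition pullback_action : continuous_action H X :=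
  @discrete_action H X (fun g => phi (sigma g)) pullback_act1 pullback_actM
    (fun g => @act_fun_continuous G X phi (sigma g)).

End Transport.

(** An isomorphism identifies the actions of the two groups, their distances and
    their pseudo orbits, provided that S is moved along with it. *)
Lemma persistent_shadowing_pullback (R : realType) (X : metricType R)
    (G H : groupType) (sigma : H -> G) (theta : G -> H)
    (sigmaM : {morph sigma : x y / (x * y)%g})
    (thetaM : {morph theta : x y / (x * y)%g})
    (S : seq G) (phi : continuous_action G X) :
  cancel sigma theta -> cancel theta sigma ->
  persistent_shadowing S phi ->
  persistent_shadowing (map theta S) (pullback_action sigmaM phi).
Proof.
move=> sigmaK thetaK phiP eps eps0; have [d d0 {}phiP] := phiP eps eps0.
exists d => // psi psi_near F FP.
have [||p pP] := phiP (pullback_action thetaM psi) _ (F \o theta).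
- apply: le_lt_trans psi_near; apply: ge_ereal_sup => _ [x _ [s sS <-]].
  apply: ereal_sup_ubound; exists x => //; exists (theta s).
    exact: map_f.
  by rewrite /= thetaK.
- by move=> s g sS /=; rewrite thetaM FP// map_f.
by exists p => g; have := pP (sigma g); rewrite /= sigmaK.
Qed.

(** The endomorphism that fixes a and sends b to c b.  For c = a^-1 it sends b to
    a^-1 b, and the one for c = a is its inverse. *)
Definition shear (c : F2) : F2 -> F2 :=
  fg_lift (fun t : bool => if t then (c * F2b)%g else F2a).

Lemma shear_gen c t : shear c (fg_gen t) = if t then (c * F2b)%g else F2a.
Proof. exact: fg_lift_gen. Qed.

Lemma shearM c : {morph shear c : x y / (x * y)%g}.
Proof. exact: fg_liftM. Qed.

(** Both sides are endomorphisms, so it suffices to compare them on a and b. *)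
Lemma shearK c c' : shear c' c = c -> (c * c' = 1)%g ->
  cancel (shear c) (shear c').
Proof.
move=> c'c cc' x.
rewrite -[RHS](_ : fg_lift (@fg_gen _) x = x); last first.
  by rewrite -(@fg_lift_unique _ _ _ id).
apply: (@fg_lift_unique _ _ _ (shear c' \o shear c)) => [y z|t] /=.
  by rewrite !shearM.
rewrite shear_gen; case: t; last by rewrite shear_gen.
by rewrite shearM c'c shear_gen mulgA cc' mul1g.
Qed.

Theorem proposition2p6 (R : realType) (X : metricType R)
    (S : seq F2) (phi : continuous_action F2 X) :
  compact [set: X]%classic ->
  generates S ->
  persistent_shadowing S phi ->
  homeo_persistent_shadowing (act_homeo phi (F2a^-1 * F2b)%g).
Proof.
move=> cX _ phiP.
have a_fix c : shear c F2a = F2a by rewrite shear_gen.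
have aV_fix c : shear c F2a^-1%g = F2a^-1%g.
  have sM : shear c (F2a^-1 * F2a)%g = (shear c F2a^-1 * F2a)%g.
    by rewrite shearM a_fix.
  apply: (mulIg F2a); rewrite -sM mulVg.
  by rewrite /shear /fg_lift big_nil.
have psiP := persistent_shadowing_pullback
  (shearM F2a^-1) (shearM F2a)
  (shearK (aV_fix _) (mulVg _)) (shearK (a_fix _) (mulgV _)) phiP.
have := @generator_persistent_shadowing _ _ _ _ _ true cX psiP.
rewrite /homeo_persistent_shadowing /= shear_gen.
exact.
Qed.
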